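(* Let $G$ be a twin-free graph and let $H$ be a graph (such that $G\Box H$ has an identifying code). Then $\gamma^{\rm ID}(G\Box H) \ge \gamma^{\rm ID}(G)\,\rho_2(H)$.
   Context: All graphs are finite, simple and undirected. $N[x]$ denotes the closed neighborhood of $x$. Two distinct vertices $x,y$ are twins if $N[x]=N[y]$; a graph is twin-free if it has no twins. An identifying code (ID code) of a graph $F$ is a set $C\subseteq V(F)$ such that $N[x]\cap C\neq\emptyset$ for every vertex $x$ and $N[x]\cap C\neq N[y]\cap C$ for all distinct vertices $x,y$. A graph has an ID code if and only if it is twin-free, and $\gamma^{\rm ID}(F)$ denotes the minimum cardinality of an ID code of $F$. A 2-packing of a graph $H$ is a set of vertices any two distinct members of which are at distance at least $3$ (vertices in different components count as being at distance $\infty$); $\rho_2(H)$ is the largest cardinality of a 2-packing of $H$. $G\Box H$ denotes the Cartesian product. *)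

(* Defs.v *)
From HB Require Import structures.
From mathcomp Require Import all_boot.

Set Implicit Arguments.
Unset Strict Implicit.
Unset Printing Implicit Defensive.

Record sgraph := SGraph {
  svertex :> finType;
  sedge : rel svertex;
  sedge_sym : symmetric sedge;
  sedge_irrefl : irreflexive sedge
}.

Definition cl_nbhd (G : sgraph) (x : G) : {set G} :=
  [set y | (y == x) || sedge x y].

Definition twins (G : sgraph) (x y : G) : bool :=
  (x != y) && (cl_nbhd x == cl_nbhd y).

Definition twin_free (G : sgraph) : bool :=
  [forall x : G, forall y : G, ~~ twins x y].

Definition id_code (G : sgraph) (C : {set G}) : bool :=
  [forall x : G, cl_nbhd x :&: C != set0] &&
  [forall x : G, forall y : G,
     (x != y) ==> (cl_nbhd x :&: C != cl_nbhd y :&: C)].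

(* The whole vertex set can start the minimisation: it is an ID code as soon as
   there is one (see [id_code_setT], [id_code_twin_free], [gammaIDP]).  If there
   is no ID code the value is #|G|, by convention only. *)
Definition gammaID (G : sgraph) : nat :=
  #|[arg min_(C < [set: G] | id_code C) #|C|]|.

Definition walk_of_length (G : sgraph) (x y : G) (k : nat) : bool :=
  [exists p : k.-tuple G, path (@sedge G) x p && (last x p == y)].

(* [None] is the infinite distance.  Searching the lengths k < #|G| suffices,
   since a shortest walk repeats no vertex (see [distP]). *)
Definition dist (G : sgraph) (x y : G) : option nat :=
  let k := find (walk_of_length x y) (iota 0 #|G|) in
  if k < #|G| then Some k else None.

Definition dist_ge (n : nat) (d : option nat) : bool :=
  if d is Some k then n <= k else true.

Definition two_packing (H : sgraph) (S : {set H}) : bool :=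
  [forall x in S, forall y in S, (x != y) ==> dist_ge 3 (dist x y)].

Definition rho2 (H : sgraph) : nat :=
  \max_(S : {set H} | two_packing S) #|S|.

Definition cart_rel (G H : sgraph) : rel (G * H) :=
  fun u v => ((u.1 == v.1) && sedge u.2 v.2)
          || ((u.2 == v.2) && sedge u.1 v.1).

Lemma cart_rel_sym (G H : sgraph) : symmetric (@cart_rel G H).
Proof.
move=> u v; rewrite /cart_rel (eq_sym u.1) (eq_sym u.2).
by rewrite (sedge_sym u.1) (sedge_sym u.2).
Qed.

Lemma cart_rel_irrefl (G H : sgraph) : irreflexive (@cart_rel G H).
Proof. by move=> u; rewrite /cart_rel !sedge_irrefl !andbF. Qed.

Definition cart_prod (G H : sgraph) : sgraph :=
  @SGraph (G * H)%type (@cart_rel G H)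
    (@cart_rel_sym G H) (@cart_rel_irrefl G H).

Lemma id_code_setT (G : sgraph) : id_code [set: G] = twin_free G.
Proof.
apply/andP/forallP => [[_ /forallP inj] x|tf].
  apply/forallP => y; move/forallP/(_ y): (inj x); rewrite !setIT /twins.
  by case: (x == y).
split; apply/forallP => x.
  by apply/set0Pn; exists x; rewrite setIT inE eqxx.
apply/forallP => y; move/forallP/(_ y): (tf x); rewrite !setIT /twins.
by case: (x == y).
Qed.

Lemma id_code_twin_free (G : sgraph) (C : {set G}) : id_code C -> twin_free G.
Proof.
case/andP => _ /forallP inj; apply/forallP => x; apply/forallP => y.
move/forallP/(_ y): (inj x); rewrite /twins; case: (x == y) => //=.
by apply: contraNN => /eqP->.
Qed.

Lemma gammaIDP (G : sgraph) : twin_free G ->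
  (exists2 C : {set G}, id_code C & #|C| = gammaID G) /\
  (forall C : {set G}, id_code C -> gammaID G <= #|C|).
Proof.
rewrite -id_code_setT /gammaID => cT.
by case: arg_minnP => // C cC minC; split=> //; exists C.
Qed.

Lemma walk_of_lengthP (G : sgraph) (x y : G) (k : nat) :
  reflect (exists p : seq G, [/\ path (@sedge G) x p, last x p = y
                               & size p = k])
          (walk_of_length x y k).
Proof.
apply: (iffP existsP) => [[p /andP[ep /eqP lp]]|[p [ep lp /eqP sp]]].
  by exists p; rewrite size_tuple.
by exists (Tuple sp); rewrite /= ep lp eqxx.
Qed.

Lemma distP (G : sgraph) (x y : G) :
  match dist x y with
  | Some k => walk_of_length x y k /\
              (forall j, walk_of_length x y j -> k <= j)
  | None => forall j, ~~ walk_of_length x y j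
  end.
Proof.
have short j : walk_of_length x y j ->
    exists2 i, i < #|G| & (i <= j) && walk_of_length x y i.
  case/walk_of_lengthP => p [ep lp <-].
  move: lp; case/shortenP: ep => p' ep' up' sub lp'.
  exists (size p').
    by rewrite -[_.+1]/(size (x :: p')) -(card_uniqP up') max_card.
  apply/andP; split; last by apply/walk_of_lengthP; exists p'.
  by apply: uniq_leq_size sub; case/andP: up'.
rewrite /dist; case: ifP => [lt_k|/negbT].
  have hs : has (walk_of_length x y) (iota 0 #|G|).
    by rewrite has_find size_iota.
  have := nth_find 0 hs; rewrite nth_iota // add0n => wk.
  split=> // j /short [i lt_i /andP[le_ij wi]]; apply: leq_trans le_ij.
  rewrite leqNgt; apply/negP => lt_ik.
  by have := before_find 0 lt_ik; rewrite nth_iota // add0n wi.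
rewrite -[X in _ < X](size_iota 0) -has_find => /hasPn no j.
apply/negP => /short [i lt_i /andP[_ wi]].
have := no i; rewrite mem_iota /= add0n => /(_ lt_i).
by rewrite wi.
Qed.

(* Main.v *)
(** For a 2-packing [S] of [H] the sets [G * N[h]], [h] in [S], are disjoint, so
    it suffices that an ID code [C] of the product has at least [gammaID G]
    elements in each of them.  Let [A] be the trace of [C] on the layer [G * {h}]
    and [B] the projection to [G] of its trace on the layers of the neighbours of
    [h].  Outside [B] the traces [N[g] :&: A] are nonempty and pairwise distinct,
    because there they are the traces [N[(g, h)] :&: C].  As [G] is twin-free,
    [A] extends to an ID code of [G] by adding at most one vertex per element of
    [B], as in the proof of Bondy's theorem. *)
Require Import Defs.
From HB Require Import structures.
From mathcomp Require Import all_boot.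

(** Induction on [#|B|], releasing one [b] from [B] at a time. As traces on [A] are distinct outside
    [B], at most one [t] there shares the trace of [b]. One point where [N t] and [N b] differ then
    repairs the clash, and enlarging [A] never merges distinct traces. *)
Lemma extend_separating (T U : finType) (N : T -> {set U}) (A : {set U})
    (B : {set T}) :
  injective N -> {in ~: B &, injective (fun t => N t :&: A)} ->
  exists2 C : {set U}, injective (fun t => N t :&: C) & #|C| <= #|A| + #|B|.
Proof.
move=> injN; have [n] := ubnP #|B|; elim: n A B => // n IHn A B ltBn injA.
have [B0|[b bB]] := set_0Vmem B.
  exists A; last exact: leq_addr.
  by move=> s t; apply: injA; rewrite B0 setC0 inE.
have cardB : #|B| = #|B :\ b|.+1 by rewrite (cardsD1 b) bB.
have ltBbn : #|B :\ b| < n by rewrite -ltnS -cardB.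
have inB t : t \in ~: (B :\ b) -> t = b \/ t \in ~: B.
  by rewrite !inE negb_and negbK => /orP[/eqP|]; [left|right].
case: (pickP [pred t in ~: B | N t :&: A == N b :&: A]) => [t|no_t].
  case/andP=> tB /eqP eq_tb.
  have [u ub] : exists u, (u \in N t) != (u \in N b).
    apply/existsP; apply: contraT => /existsPn same.
    move: tB; suff -> : t = b by rewrite inE bB.
    by apply: injN; apply/setP => u; apply/eqP/negbNE.
  have eqA s s' : N s :&: (u |: A) = N s' :&: (u |: A) ->
      N s :&: A = N s' :&: A /\ (u \in N s) = (u \in N s').
    move=> /setP eq_ss'; split; last first.
      by have:= eq_ss' u; rewrite !inE eqxx !andbT.
    apply/setP => v; have := eq_ss' v; rewrite !inE.
    by case: (v \in A); rewrite ?andbF // orbT.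
  (* A clash of [s] with [b] on [u |: A] would force [s = t] by [injA], but [u] tells [t] from
     [b]. *)
  have sep_b s : s \in ~: B -> N s :&: (u |: A) <> N b :&: (u |: A).
    move=> sB /eqA[eqsb equ]; move: ub.
    by rewrite -equ (injA t s) ?eqxx //= eq_tb.
  have injA' : {in ~: (B :\ b) &, injective (fun t => N t :&: (u |: A))}.
    move=> s s' /inB[->|sB] /inB[->|s'B] //= E; first by case: (sep_b s').
      by case: (sep_b s).
    by apply: injA => //; have [] := eqA _ _ E.
  have [C injC leC] := IHn (u |: A) (B :\ b) ltBbn injA'.
  exists C => //; apply: leq_trans leC _.
  by rewrite cardB addnS -addSn leq_add2r cardsU1 -add1n leq_add2r leq_b1.
(* Here [A] already separates [b], so [b] is released at no cost. *)
have sep_b s : s \in ~: B -> N s :&: A <> N b :&: A.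
  by move=> sB /eqP E; have := no_t s; rewrite inE /= sB E.
have injAb : {in ~: (B :\ b) &, injective (fun t => N t :&: A)}.
  move=> s s' /inB[->|sB] /inB[->|s'B] //= E; first by case: (sep_b s').
    by case: (sep_b s).
  exact: injA.
have [C injC leC] := IHn A (B :\ b) ltBbn injAb.
by exists C => //; rewrite (leq_trans leC) // cardB addnS.
Qed.

(** Otherwise a walk through [z] would join [x] to [y] in at most two steps. *)
Lemma two_packing_nbhd_inj (H : sgraph) (S : {set H}) (x y z : H) :
  two_packing S -> x \in S -> y \in S ->
  z \in cl_nbhd x -> z \in cl_nbhd y -> x = y.
Proof.
move=> /forall_inP packS xS yS; rewrite !inE => zx zy; apply/eqP.
apply: contraT => neq_xy.
have := packS x xS => /forall_inP/(_ y yS)/implyP/(_ neq_xy) far.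
have [k lek2 wk] : exists2 k, k <= 2 & walk_of_length x y k.
  case/orP: zx zy => [/eqP->|xz] /orP[/eqP eq_zy|].
  - by rewrite eq_zy eqxx in neq_xy.
  - rewrite sedge_sym => xy; exists 1 => //; apply/walk_of_lengthP.
    by exists [:: y]; rewrite /= xy.
  - exists 1 => //; apply/walk_of_lengthP.
    by exists [:: y]; rewrite /= -eq_zy xz.
  rewrite sedge_sym => zy; exists 2 => //; apply/walk_of_lengthP.
  by exists [:: z; y]; rewrite /= xz zy.
have := distP x y; case: (dist x y) far => [d /= le3d [_ /(_ k wk) ledk]|_].
  by have := leq_trans le3d (leq_trans ledk lek2).
by move/(_ k); rewrite wk.
Qed.

Lemma gammaID_le_layers (G H : sgraph) (C : {set cart_prod G H}) (h : H) :
  twin_free G -> id_code C ->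
  gammaID G <= #|[set u in C | u.2 \in cl_nbhd h]|.
Proof.
move=> tfG /andP[/forallP domC /forallP sepC].
set L := [set u in C | _]; pose M := [set u : cart_prod G H | u.2 == h].
pose A := [set u.1 | u in L :&: M]; pose B := [set u.1 | u in L :\: M].
(* For [g] outside [B], no codeword adjacent to [(g, h)] lies in another layer. *)
have traceC (g : G) : g \notin B ->
    @cl_nbhd (cart_prod G H) (g, h) :&: C
      = [set ((x, h) : cart_prod G H) | x in cl_nbhd g :&: A].
  move=> gB; apply/setP => -[x k]; apply/setIP/imsetP => [[]|[y]].
    rewrite inE /= /cart_rel /= xpair_eqE => adj xkC.
    have eq_kh : k = h.
      apply/eqP; apply: contraNT gB => neq_kh.
      move: adj; rewrite (negPf neq_kh) (eq_sym h) (negPf neq_kh) andbF /= orbF.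
      case/andP=> /eqP-> hk; apply/imsetP; exists (x, k) => //.
      by rewrite !inE neq_kh xkC /= hk orbT.
    rewrite eq_kh in adj xkC *; exists x => //; rewrite !inE; apply/andP; split.
      by move: adj; rewrite sedge_irrefl eqxx andbT andbF.
    by apply/imsetP; exists (x, h) => //; rewrite !inE xkC /= eqxx.
  case/setIP=> gy /imsetP[[z l]]; rewrite !inE /=.
  move=> /andP[/andP[zlC _] /eqP lh] /= yz [-> ->]; rewrite yz -lh; split=> //.
  move: gy; rewrite !inE yz /= /cart_rel /= xpair_eqE lh eqxx andbT.
  by case/orP=> -> //; rewrite !orbT.
(* The extra index [None], with empty neighbourhood, turns domination into separation from [None],
   so that a single separating set [D] gives both conditions of an ID code. *)
pose N (o : option G) : {set G} := if o is Some g then cl_nbhd g else set0.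
have injN : injective N.
  have nbhd_n0 (g : G) : cl_nbhd g <> set0.
    by move/setP/(_ g); rewrite !inE eqxx.
  move=> [g|] [g'|] //= E; last by case: (nbhd_n0 g').
    congr Some; apply/eqP; move/forallP/(_ g)/forallP/(_ g'): tfG.
    by rewrite /twins E eqxx andbT negbK.
  by case: (nbhd_n0 g).
have SomeB g : Some g \in ~: (Some @: B) -> g \notin B.
  by rewrite inE; apply: contra => gB; apply: imset_f.
have domA g : g \notin B -> cl_nbhd g :&: A <> set0.
  by move=> gB E; have := domC (g, h); rewrite traceC // E imset0 eqxx.
have injA : {in ~: (Some @: B) &, injective (fun o => N o :&: A)}.
  move=> [g|] [g'|] //= => [/SomeB gB /SomeB g'B E|/SomeB gB _|_ /SomeB gB].
  - congr Some; apply/eqP; apply: contraT => neq_gg'.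
    have := sepC (g, h) => /forallP/(_ (g', h)).
    by rewrite !traceC // E eqxx xpair_eqE (negPf neq_gg').
  - by rewrite set0I => /(domA _ gB).
  by rewrite set0I => /esym/(domA _ gB).
have [D injD leD] := extend_separating _ _ _ _ _ injN injA.
apply: (@leq_trans #|D|).
  apply: (gammaIDP tfG).2; apply/andP; split; apply/forallP => g.
    apply/eqP => E; have := injD (Some g) None.
    by rewrite /= E set0I => /(_ erefl).
  apply/forallP => g'; apply/implyP; apply: contraNN => /eqP E.
  by have [->] := injD (Some g) (Some g') E.
(* [A] and [B] are images of the two parts into which [M] splits [L]. *)
apply: leq_trans leD _; rewrite -(cardsID M L).
by rewrite leq_add ?(leq_trans (leq_imset_card Some _)) ?leq_imset_card.
Qed.

Theorem theorem10 (G H : sgraph)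
    (twin_free_G : twin_free G)
    (id_code_GH : exists C : {set cart_prod G H}, id_code C) :
  gammaID G * rho2 H <= gammaID (cart_prod G H).
Proof.
have [C0 /id_code_twin_free/gammaIDP[[C idC <-] _]] := id_code_GH.
rewrite /rho2; elim/big_ind: _ => [|m n lem len|S packS].
  by rewrite muln0.
  by rewrite maxnMr geq_max lem.
rewrite mulnC -sum_nat_const.
apply: (@leq_trans (\sum_(h in S) #|[set u in C | u.2 \in cl_nbhd h]|)).
  by apply: leq_sum => h _; apply: gammaID_le_layers.
(* Double counting: each [u] in [C] is counted for at most one [h] in [S]. *)
under eq_bigr do rewrite -sum1dep_card.
rewrite (exchange_big_dep (mem C)) /= => [|h u _ /andP[] //].
rewrite -sum1_card; apply: leq_sum => u uC; rewrite sum1dep_card.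
apply/card_le1_eqP => x y; rewrite !inE uC /=.
case/andP=> xS ux /andP[yS uy].
by apply: (two_packing_nbhd_inj _ _ _ _ u.2 packS) => //; rewrite inE.
Qed.
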